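(* Let $p/q\ge 4$ be a rational number in lowest terms with $q\ge 1$, let $a_0=\lfloor p/q\rfloor$, and write $p/q=a_0+k/q$ with $0\le k<q$. Let the open intervals $I^{0,\pm}_{p/q}$ and $I^{1,\pm}_{p/q}$ be as defined in the context. Then: (1) $I^{0,+}_{p/q}$ contains an integer $d$ if and only if $k^2\equiv -1 \pmod q$ and $2a_0\equiv k\,\frac{1+k^2}{q}\pmod q$. (2) $I^{0,-}_{p/q}$ contains an integer $d$ if and only if $k^2\equiv 1 \pmod q$ and $2a_0\equiv k\,\frac{1-k^2}{q}\pmod q$. (3) $I^{1,+}_{p/q}$ contains an integer $d\equiv 1 \pmod 4$ if and only if $k^2\equiv -1 \pmod q$ and $2a_0\equiv 1+k\,\frac{1+k^2}{q}\pmod q$. (4) $I^{1,-}_{p/q}$ contains an integer $d\equiv 1 \pmod 4$ if and only if $k^2\equiv 1 \pmod q$ and $2a_0\equiv 1+k\,\frac{1-k^2}{q}\pmod q$. In each case the integer $d$ is given by $$d=\begin{cases} a_0^2+\frac{2k}{q}a_0+\frac{k^2+1}{q^2} & \text{in case (1)},\\ a_0^2+\frac{2k}{q}a_0+\frac{k^2-1}{q^2} & \text{in case (2)},\\ (2a_0-1)^2+\frac{4k}{q}(2a_0-1)+\frac{4k^2+4}{q^2} & \text{in case (3)},\\ (2a_0-1)^2+\frac{4k}{q}(2a_0-1)+\frac{4k^2-4}{q^2} & \text{in case (4)},\end{cases}$$ and $$N(p-q\sqrt d)=\begin{cases}-1 & \text{in case (1)},\\ 1 & \text{in case (2)},\end{cases}\qquad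 N\!\left(p-q\,\tfrac{1+\sqrt d}{2}\right)=\begin{cases}-1 & \text{in case (3)},\\ 1 & \text{in case (4)}.\end{cases}$$
   Context: Continued fractions: $[c_0,c_1,\dots,c_r]=c_0+\cfrac{1}{c_1+\cfrac{1}{\ddots+\frac{1}{c_r}}}$; the last entry may be any positive real number. Definition of the intervals. A rational number $p/q>1$ in lowest terms has a unique expansion $p/q=[b_0,b_1,\dots,b_m,1]=[b_0,\dots,b_{m-1},b_m+1]$ with $m\ge 0$, $b_i$ integers and $b_i\ge1$ for $i\ge 1$. (If $q\ne1$ then $b_0=\lfloor p/q\rfloor$; if $q=1$ then $m=0$ and $b_0=p-1$.) Let $q_{m-1}$ and $q_m$ be the denominators of $[b_0,\dots,b_{m-1}]$ and $[b_0,\dots,b_m]$ (with $q_{-1}=0$, $q_0=1$). Put $$A=\left[b_0,\dots,b_{m-1},b_m+1,\tfrac43 b_0-\tfrac{q_{m-1}}{q}\right],\qquad B=\left[b_0,\dots,b_m,1,\tfrac43 b_0-\tfrac{q_m}{q}\right].$$ Let $I^0_{p/q}=(A^2,B^2)$ if $m$ is odd and $(B^2,A^2)$ if $m$ is even; let $I^1_{p/q}=((2A-1)^2,(2B-1)^2)$ if $m$ is odd and $((2B-1)^2,(2A-1)^2)$ if $m$ is even. The point $p^2/q^2$ lies in $I^0_{p/q}$ and $(2p/q-1)^2$ lies in $I^1_{p/q}$. Let $I^{0,-}_{p/q}$ and $I^{0,+}_{p/q}$ be the left and right connected components (open intervals) of $I^0_{p/q}\setminus\{p^2/q^2\}$,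 and let $I^{1,-}_{p/q}$ and $I^{1,+}_{p/q}$ be the left and right connected components of $I^1_{p/q}\setminus\{(2p/q-1)^2\}$. Congruences such as $2a_0\equiv k\frac{1+k^2}{q}\pmod q$ are to be read together with the accompanying congruence on $k^2$, which makes the fraction an integer. $N$ denotes the norm, $N(x)=x\overline{x}$ with $\overline{x}$ the conjugate of $x$ under $\sqrt d\mapsto-\sqrt d$; thus $N(p-q\sqrt d)=p^2-q^2d$ and $N(p-q\frac{1+\sqrt d}{2})=p^2-pq+q^2\frac{1-d}{4}$.
   Formalization: In case (1) with p/q = 4, I^{0,+} = (16, 289/16) contains both 17 and 18, so ''the integer d'' is not unique; there it is only claimed that some integer d in the interval has the given value and norm, while for p/q ≠ 4 every such d does. *)

(* Defs.v *)
From HB Require Import structures.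
From mathcomp Require Import all_boot all_order all_algebra.
From mathcomp Require Import ring lra.
From mathcomp Require Import all_classical all_reals topology normedtype.

Set Implicit Arguments.
Unset Strict Implicit.
Unset Printing Implicit Defensive.

Import Order.TTheory GRing.Theory Num.Theory.
Import numFieldNormedType.Exports.

Local Open Scope classical_set_scope.
Local Open Scope ring_scope.

(* [cfrac [:: c_0; ...; c_r]] is [c_0, ..., c_r]; the empty list gives a junk
   value. *)
Fixpoint cfrac (F : fieldType) (s : seq F) : F :=
  match s with
  | [::] => 0
  | [:: c] => c
  | c :: s' => c + (cfrac s')^-1
  end.

(* b_0, ..., b_{n-1} as rationals *)
Definition partial_quotients (b : nat -> int) (n : nat) : seq rat :=
  mkseq (fun i => (b i)%:Q) n.

(* x = [b_0, ..., b_m, 1] with b_i >= 1 for i >= 1; the values of b beyond m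
   are irrelevant. *)
Definition is_expansion (x : rat) (m : nat) (b : nat -> int) : Prop :=
  (forall i : nat, (1 <= i <= m)%N -> 1 <= b i) /\
  x = cfrac (partial_quotients b m.+1 ++ [:: 1]).

(* Denominator of [b_0, ..., b_{n-1}], i.e. q_{n-1}, with q_{-1} = 0. *)
Definition conv_den (b : nat -> int) (n : nat) : int :=
  if n is 0%N then 0 else denq (cfrac (partial_quotients b n)).

Definition endA (q : int) (m : nat) (b : nat -> int) : rat :=
  cfrac (partial_quotients b m ++
    [:: (b m)%:Q + 1; 4 / 3 * (b 0%N)%:Q - (conv_den b m)%:Q / q%:Q]).

Definition endB (q : int) (m : nat) (b : nat -> int) : rat :=
  cfrac (partial_quotients b m.+1 ++
    [:: 1; 4 / 3 * (b 0%N)%:Q - (conv_den b m.+1)%:Q / q%:Q]).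

Definition open_itv (R : realType) (x y : rat) : set R :=
  `]ratr x, ratr y[%classic.
Arguments open_itv : clear implicits.

Definition I0 (R : realType) (q : int) (m : nat) (b : nat -> int) : set R :=
  let A := endA q m b in
  let B := endB q m b in
  if odd m then open_itv R (A ^+ 2) (B ^+ 2) else open_itv R (B ^+ 2) (A ^+ 2).
Arguments I0 : clear implicits.

Definition I1 (R : realType) (q : int) (m : nat) (b : nat -> int) : set R :=
  let A := 2 * endA q m b - 1 in
  let B := 2 * endB q m b - 1 in
  if odd m then open_itv R (A ^+ 2) (B ^+ 2) else open_itv R (B ^+ 2) (A ^+ 2).
Arguments I1 : clear implicits.

(* For an interval S with c in its interior, S `\ c has two connected
   components; these are the one to the left of c and the one to the right. *)
Definition left_component (R : realType) (S : set R) (c : R) : set R :=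
  \bigcup_(y in [set y | (S `\ c) y /\ y < c]) connected_component (S `\ c) y.

Definition right_component (R : realType) (S : set R) (c : R) : set R :=
  \bigcup_(y in [set y | (S `\ c) y /\ c < y]) connected_component (S `\ c) y.

Definition I0l (R : realType) (p q : int) (m : nat) (b : nat -> int) : set R :=
  left_component (I0 R q m b) (ratr ((p%:Q / q%:Q) ^+ 2)).
Arguments I0l : clear implicits.

Definition I0r (R : realType) (p q : int) (m : nat) (b : nat -> int) : set R :=
  right_component (I0 R q m b) (ratr ((p%:Q / q%:Q) ^+ 2)).
Arguments I0r : clear implicits.

Definition I1l (R : realType) (p q : int) (m : nat) (b : nat -> int) : set R :=
  left_component (I1 R q m b) (ratr ((2 * (p%:Q / q%:Q) - 1) ^+ 2)).
Arguments I1l : clear implicits.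

Definition I1r (R : realType) (p q : int) (m : nat) (b : nat -> int) : set R :=
  right_component (I1 R q m b) (ratr ((2 * (p%:Q / q%:Q) - 1) ^+ 2)).
Arguments I1r : clear implicits.

(* Q[sqrt d] = Q[X]/(X^2 - d), with Quad x y standing for x + y sqrt d. It is
   the field Q(sqrt d) when d is not a square; conjugation is well defined for
   every d. *)
Record quad (d : int) : Type := Quad { qrat : rat; qirr : rat }.

Section QuadRing.
Variable d : int.
Implicit Types x y z : quad d.

Let pair_of_quad x : rat * rat := (qrat x, qirr x).
Let quad_of_pair (u : rat * rat) : quad d := Quad d u.1 u.2.
Fact quad_pairK : cancel pair_of_quad quad_of_pair. Proof. by case. Qed.

HB.instance Definition _ := Choice.copy (quad d) (can_type quad_pairK).

Definition quad_zero : quad d := Quad d 0 0.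
Definition quad_one : quad d := Quad d 1 0.
Definition quad_opp x : quad d := Quad d (- qrat x) (- qirr x).
Definition quad_add x y : quad d := Quad d (qrat x + qrat y) (qirr x + qirr y).
Definition quad_mul x y : quad d :=
  Quad d (qrat x * qrat y + d%:Q * (qirr x * qirr y))
         (qrat x * qirr y + qirr x * qrat y).
Definition quad_scale (c : rat) x : quad d := Quad d (c * qrat x) (c * qirr x).

Fact quad_addA : associative quad_add.
Proof. by move=> [a a'] [b b'] [c c']; congr Quad => /=; ring. Qed.
Fact quad_addC : commutative quad_add.
Proof. by move=> [a a'] [b b']; congr Quad => /=; ring. Qed.
Fact quad_add0 : left_id quad_zero quad_add.
Proof. by move=> [a a']; congr Quad => /=; ring. Qed.
Fact quad_addN : left_inverse quad_zero quad_opp quad_add.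
Proof. by move=> [a a']; congr Quad => /=; ring. Qed.

HB.instance Definition _ := GRing.isZmodule.Build (quad d)
  quad_addA quad_addC quad_add0 quad_addN.

Fact quad_mulA : associative quad_mul.
Proof. by move=> [a a'] [b b'] [c c']; congr Quad => /=; ring. Qed.
Fact quad_mulC : commutative quad_mul.
Proof. by move=> [a a'] [b b']; congr Quad => /=; ring. Qed.
Fact quad_mul1 : left_id quad_one quad_mul.
Proof. by move=> [a a']; congr Quad => /=; ring. Qed.
Fact quad_mulD : left_distributive quad_mul +%R.
Proof. by move=> [a a'] [b b'] [c c']; congr Quad => /=; ring. Qed.
Fact quad_one_neq0 : quad_one != 0.
Proof. by apply/eqP => -[]. Qed.

HB.instance Definition _ := GRing.Zmodule_isComNzRing.Build (quad d)
  quad_mulA quad_mulC quad_mul1 quad_mulD quad_one_neq0.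

Fact quad_scaleA (a b : rat) x :
  quad_scale a (quad_scale b x) = quad_scale (a * b) x.
Proof. by congr Quad => /=; ring. Qed.
Fact quad_scale1 : left_id 1 quad_scale.
Proof. by move=> [a a']; congr Quad => /=; ring. Qed.
Fact quad_scaleDr : right_distributive quad_scale +%R.
Proof. by move=> c [a a'] [b b']; congr Quad => /=; ring. Qed.
Fact quad_scaleDl x : {morph quad_scale^~ x : a b / a + b}.
Proof. by move=> a b; congr Quad => /=; ring. Qed.

HB.instance Definition _ := GRing.Zmodule_isLmodule.Build rat (quad d)
  quad_scaleA quad_scale1 quad_scaleDr quad_scaleDl.

Definition qsqrt : quad d := Quad d 0 1.

Definition qconj x : quad d := Quad d (qrat x) (- qirr x).

Definition qnorm x : quad d := x * qconj x.

Lemma quad_intE (n : int) : n%:~R = Quad d n%:Q 0.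
Proof.
elim/int_rec: n => [//|n IH|n IH].
  by rewrite -addn1 PoszD !intrD IH; congr Quad.
by rewrite -addn1 PoszD opprD !intrD IH; congr Quad.
Qed.

Lemma qsqrtK : qsqrt ^+ 2 = d%:~R.
Proof. by rewrite quad_intE expr2; congr Quad => /=; ring. Qed.

Lemma qnorm_sqrt (p q : int) :
  qnorm (p%:~R - q%:~R * qsqrt) = (p ^+ 2 - q ^+ 2 * d)%:~R.
Proof. by rewrite !quad_intE; congr Quad => /=; ring. Qed.

Lemma qnorm_half (p q : int) :
  qnorm (p%:~R - q%:~R * (2^-1 *: (1 + qsqrt))) =
  Quad d (p%:Q ^+ 2 - p%:Q * q%:Q + q%:Q ^+ 2 * ((1 - d%:Q) / 4)) 0.
Proof. by rewrite !quad_intE; congr Quad => /=; field. Qed.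

End QuadRing.

Lemma expansion_exists (p q : int) :
  0 < q -> q < p -> exists m b, is_expansion (p%:Q / q%:Q) m b.
Proof.
suff H (n : nat) : forall p q : int, 0 < q -> q < p -> (`|q| <= n)%N ->
    exists m b, is_expansion (p%:Q / q%:Q) m b /\ 1 <= b 0%N.
  move=> q0 qp; have [m [b [? _]]] := H _ p q q0 qp (leqnn _).
  by exists m, b.
elim: n => [|n IH] {}p {}q q0 qp qn.
  by move: qn; rewrite leqn0 absz_eq0 gt_eqF.
have qQ : q%:Q != 0 by rewrite intr_eq0 gt_eqF.
have := divz_eq p q; have := modz_ge0 p (lt0r_neq0 q0).
have := ltz_pmod p q0.
set a := (p %/ q)%Z; set r := (p %% q)%Z => rq r0 pE.
have a1 : 1 <= a by rewrite /a lez_divRL // mul1r ltW.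
have pEQ : p%:Q = a%:Q * q%:Q + r%:Q by rewrite pE intrD intrM.
case: (eqVneq r 0) => [rz|rn].
  exists 0%N, (fun=> a - 1); split; last first.
    rewrite -(ler_pM2r q0) mul1r.
    have : q < a * q by rewrite -[a * q]addr0 -rz -pE.
    rewrite -{1}[q]mul1r ltr_pM2r // => a2.
    have : 1 <= a - 1 by rewrite lerBrDr.
    by move=> h; rewrite -{1}[q]mul1r ler_pM2r.
  split; first by move=> i /andP[i1]; rewrite leqNgt i1.
  rewrite /partial_quotients /= invr1 intrB subrK pEQ rz addr0.
  by rewrite mulfK.
have r1 : 0 < r by rewrite lt_def rn r0.
have rn' : (`|r| <= n)%N.
  by rewrite -ltnS (leq_trans _ qn) // -ltz_nat !gez0_abs // ltW.
have [m [b [[b1 bE] b0]]] := IH q r r1 rq rn'.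
exists m.+1, (fun i => if i is j.+1 then b j else a); split => //; split.
  by move=> [|[|i]] //= im; apply: b1.
rewrite /partial_quotients /mkseq /=.
have -> : [seq (match i with 0%N => a | j.+1 => b j end)%:Q | i <- iota 2 m]
        = [seq (b i)%:Q | i <- iota 1 m].
  by rewrite (iotaDl 1) -map_comp.
move: bE; rewrite /partial_quotients /mkseq /= => <-.
have rQ : r%:Q != 0 by rewrite intr_eq0.
by rewrite invf_div pEQ mulrDl mulfK.
Qed.

Lemma left_component_itv (R : realType) (x y c : R) :
  x < c < y -> left_component `]x, y[%classic c = `]x, c[%classic.
Proof.
move=> /andP[xc cy]; apply/seteqP; split=> z /=.
  move=> [u [Su uc]] [C [Cu CS Cc]] Cz.
  have [Sz zc] := CS _ Cz.
  have {}zc : z != c by apply/eqP.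
  move: Sz; rewrite /= !in_itv /= => /andP[-> _] /=.
  rewrite ltNge le_eqVlt eq_sym (negPf zc) /=; apply/negP => cz.
  have /connected_intervalP /(_ u z Cu Cz c) := Cc.
  by rewrite (ltW uc) (ltW cz) => /(_ isT) /CS[_]; apply.
rewrite in_itv /= => /andP[xz zc].
have Sz : (`]x, y[%classic `\ c) z.
  split; first by rewrite /= in_itv /= xz (lt_trans zc).
  by move=> /= E; rewrite E ltxx in zc.
exists z => //; exact: connected_component_refl.
Qed.

Lemma right_component_itv (R : realType) (x y c : R) :
  x < c < y -> right_component `]x, y[%classic c = `]c, y[%classic.
Proof.
move=> /andP[xc cy]; apply/seteqP; split=> z /=.
  move=> [u [Su uc]] [C [Cu CS Cc]] Cz.
  have [Sz zc] := CS _ Cz.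
  have {}zc : z != c by apply/eqP.
  move: Sz; rewrite /= !in_itv /= => /andP[_ ->]; rewrite andbT.
  rewrite ltNge le_eqVlt (negPf zc) /=; apply/negP => cz.
  have /connected_intervalP /(_ z u Cz Cu c) := Cc.
  by rewrite (ltW uc) (ltW cz) => /(_ isT) /CS[_]; apply.
rewrite in_itv /= => /andP[cz zy].
have Sz : (`]x, y[%classic `\ c) z.
  split; first by rewrite /= in_itv /= zy (lt_trans xc).
  by move=> /= E; rewrite E ltxx in cz.
exists z => //; exact: connected_component_refl.
Qed.

(* Main.v *)
Require Import Defs.
From mathcomp Require Import all_boot all_order all_algebra.
From mathcomp Require Import all_classical all_reals.
From mathcomp Require Import ring lra zify.

Import Order.TTheory GRing.Theory Num.Theory.
Local Open Scope ring_scope.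

(** Write x = p/q.  The last entries of A and B are chosen so that, in the
    Moebius formula for a continued fraction with a real last entry, the
    denominator becomes 4/3 b_0 q.  Since the convergents before p/q have
    determinant (-1)^m or -(-1)^m with (p, q), this makes A and B symmetric
    about x: they are x + (-1)^m r and x - (-1)^m r with r = 3 / (4 b_0 q^2)
    ([endpointsE]).  Hence I^0 is the interval from (x - r)^2 to (x + r)^2, and
    similarly for I^1.

    Both cases are treated together through the form f(X) = X^2 - c X.  With
    c = 0, an integer d lies in a half of I^0 exactly when it lies between f(x)
    and f(x +- r); with c = 1, an integer d = 4 e + 1 lies in a half of I^1
    exactly when e lies between f(x) and f(x +- r).  Multiplying by q^2 turns
    f(x) into the integer p^2 - c p q and the distance from f(x) to e into an
    integer.  As b_0 < x <= b_0 + 1, the scaled half-windows have width more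
    than 1 and less than 2 ([window_width]), so this integer is 1: the half
    contains e if and only if e q^2 = p^2 - c p q +- 1, an equation that says
    that an element of the quadratic order has norm -1 or 1.  The one exception
    is the right half for c = 0 and b_0 = 3, that is x = 4, where the width
    exceeds 2; there q = 1 and the equation has a solution anyway.

    Finally, with p = a_0 q + k, the solvability of this equation is a
    divisibility by q^2, which unfolds into the two congruences modulo q
    ([sqr_dvd_normP]). *)

(** * Congruences *)

(** Modulo q the divisibility gives q | k^2 + s; writing k^2 + s = u q, what
    remains is q | (2 a - c) k + u.  As k^2 = -s is a unit modulo q, multiplying
    by k is reversible, and it isolates 2 a - c. *)
Lemma sqr_dvd_normP (q a k c s : int) : q != 0 -> s ^+ 2 = 1 ->
  (exists e : int,
     e * q ^+ 2 = (a * q + k) ^+ 2 - c * (a * q + k) * q + s) <->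
  (k ^+ 2 = - s %[mod q])%Z /\
  (2 * a = c + k * ((1 + s * k ^+ 2)%R %/ q)%Z %[mod q])%Z.
Proof.
move=> q0 s2.
have quotE u : k ^+ 2 + s = u * q -> ((1 + s * k ^+ 2) %/ q)%Z = s * u.
  move=> ku; have -> : 1 + s * k ^+ 2 = s * u * q by rewrite -mulrA -ku -s2; ring.
  by rewrite mulzK.
split=> [[e eE]|[/eqP]].
  pose w := e - a ^+ 2 + c * a.
  have ku : k ^+ 2 + s = (q * w - (2 * a - c) * k) * q.
    have : e * q ^+ 2 - ((a * q + k) ^+ 2 - c * (a * q + k) * q + s) = 0.
      by rewrite eE subrr.
    by move=> h; apply/eqP; rewrite -subr_eq0 -oppr_eq0 -h /w; apply/eqP; ring.
  split.
    by apply/eqP; rewrite eqz_mod_dvd opprK ku dvdz_mull.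
  apply/eqP; rewrite eqz_mod_dvd (quotE _ ku).
  set u := _ - _ in ku *.
  apply/dvdzP; exists ((2 * a - c) * s * u - k * s * w).
  have kE : k ^+ 2 = u * q - s by rewrite -ku addrK.
  have -> : 2 * a - (c + k * (s * u)) =
            (2 * a - c) * (1 + s * k ^+ 2) - k * s * w * q by rewrite /u; ring.
  by rewrite kE -s2; ring.
rewrite eqz_mod_dvd opprK => /dvdzP[u ku].
rewrite (quotE _ ku) => /eqP; rewrite eqz_mod_dvd => /dvdzP[v kv].
exists (a ^+ 2 - c * a + u ^+ 2 * s + k * v).
have vE : 2 * a - c = k * (s * u) + v * q by rewrite -kv; ring.
have k2 : k ^+ 2 = u * q - s by rewrite -ku; ring.
transitivity (a ^+ 2 * q ^+ 2 - c * a * q ^+ 2 + (2 * a - c) * k * q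
              + (k ^+ 2 + s)); last by ring.
rewrite vE ku -[u * q]mulr1 -s2.
transitivity (a ^+ 2 * q ^+ 2 - c * a * q ^+ 2
              + (k ^+ 2 * (s * u) * q + v * q * k * q) + u * q * s ^+ 2).
  by rewrite k2; ring.
by ring.
Qed.

(** * Convergents *)

(** The index is shifted by two: [conv_rec u v b n.+1] is the numerator or
    denominator of [b_0, ..., b_{n-1}].  Starting from the indices -2 and -1
    makes the formulas below hold for the empty list as well. *)
Fixpoint conv_rec (u v : int) (b : nat -> int) (n : nat) : int :=
  if n is n1.+1 then
    if n1 is n2.+1 then b n2 * conv_rec u v b n1 + conv_rec u v b n2 else v
  else u.

Definition cnum := conv_rec 0 1.
Definition cden := conv_rec 1 0.

Lemma cnumSS b n : cnum b n.+2 = b n * cnum b n.+1 + cnum b n.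
Proof. by []. Qed.

Lemma cdenSS b n : cden b n.+2 = b n * cden b n.+1 + cden b n.
Proof. by []. Qed.

Lemma conv_det b n :
  cnum b n.+1 * cden b n - cnum b n * cden b n.+1 = (-1) ^+ n.
Proof.
elim: n => [|n IH]; first by rewrite /cnum /cden /= expr0.
by rewrite cnumSS cdenSS exprS -IH; ring.
Qed.

Lemma cden_ge0 (b : nat -> int) n : (forall i, (i <= n)%N -> 1 <= b i) ->
  0 <= cden b n.+1 /\ 1 <= cden b n.+2.
Proof.
elim: n => [|n IH] b1; first by rewrite cdenSS /cden /= mulr0 add0r.
have [|d0 d1] := IH; first by move=> i /leqW/b1.
split; first exact: le_trans ler01 d1.
rewrite cdenSS -[1]addr0 lerD //.
by rewrite -[1]mulr1 ler_pM // b1.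
Qed.

Lemma cfrac_rcons2 (F : fieldType) (s : seq F) c t :
  cfrac (s ++ [:: c; t]) = cfrac (s ++ [:: c + t^-1]).
Proof. by elim: s => [//|a [//|a' s] /= ->]. Qed.

Lemma partial_quotientsS b n :
  partial_quotients b n.+1 = partial_quotients b n ++ [:: (b n)%:Q].
Proof. by rewrite /partial_quotients mkseqS cats1. Qed.

Lemma cden_gt0 (b : nat -> int) n (u : rat) :
  (forall i, (i < n)%N -> 1 <= b i) -> 0 < u ->
  0 < (cden b n.+1)%:Q * u + (cden b n)%:Q.
Proof.
case: n => [|n] b1 u0; first by rewrite /cden /= mul0r add0r.
have [//|d0 d1] := cden_ge0 b n.
by rewrite ltr_pwDl ?ler0z // mulr_gt0 // ltr0z (lt_le_trans _ d1).
Qed.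

(** Absorbing the entry b_n into the last one, b_n + 1/u, reduces n + 1 to n. *)
Lemma cfrac_conv (b : nat -> int) n (u : rat) :
  (forall i, (i < n)%N -> 1 <= b i) -> 0 < u ->
  cfrac (partial_quotients b n ++ [:: u]) =
  ((cnum b n.+1)%:Q * u + (cnum b n)%:Q) / ((cden b n.+1)%:Q * u + (cden b n)%:Q).
Proof.
elim: n u => [|n IH] u b1 u0.
  by rewrite /cnum /cden /= mul1r addr0 mul0r add0r divr1.
have b1' i : (i < n)%N -> 1 <= b i by move=> /ltnW/b1.
have bn : 0 < (b n)%:Q by rewrite ltr0z (lt_le_trans _ (b1 n _)).
have u'0 : 0 < (b n)%:Q + u^-1 by rewrite addr_gt0 ?invr_gt0.
rewrite partial_quotientsS -catA cfrac_rcons2 IH //.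
have dn := cden_gt0 b n _ b1' u'0; have dSn := cden_gt0 b n.+1 _ b1 u0.
move: dSn dn; rewrite cnumSS cdenSS !intrD !intrM => dSn dn.
field.
by rewrite !gt_eqF //=.
Qed.

(** * The endpoints *)

Lemma cfrac_ge1 (s : seq rat) : all (>= 1) s -> 1 <= cfrac (s ++ [:: 1]).
Proof.
elim: s => [//|a s IH] /andP[a1 /IH s1].
suff -> : cfrac (a :: s ++ [:: 1]) = a + (cfrac (s ++ [:: 1]))^-1.
  by rewrite -[leLHS]addr0 lerD // invr_ge0 (le_trans ler01).
by case: (s).
Qed.

(** b_0 is the strict floor of x because the expansion ends in 1; for an
    integer x it is x - 1. *)
Lemma expansion_head (x : rat) m b :
  is_expansion x m b -> (b 0%N)%:Q < x <= (b 0%N)%:Q + 1.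
Proof.
move=> [b1 ->].
have s1 : 1 <= cfrac ([seq (b i)%:Q | i <- iota 1 m] ++ [:: 1]).
  apply: cfrac_ge1; apply/allP => _ /mapP[i + ->].
  by rewrite mem_iota add1n ltnS => /b1; rewrite ler1z.
have -> : cfrac (partial_quotients b m.+1 ++ [:: 1]) =
    (b 0%N)%:Q + (cfrac ([seq (b i)%:Q | i <- iota 1 m] ++ [:: 1]))^-1.
  by rewrite /partial_quotients /mkseq; case: m {b1 s1}.
have s0 := lt_le_trans ltr01 s1.
by rewrite ltrDl invr_gt0 s0 lerD2l invf_le1.
Qed.

Lemma coprime_convergents b n : coprimez (cnum b n) (cden b n).
Proof.
apply/coprimezP; exists ((-1) ^+ n * - cden b n.+1, (-1) ^+ n * cnum b n.+1) => /=.
rewrite -[RHS](sqrr_sign int n) [RHS]expr2 -{4}(conv_det b n); ring.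
Qed.

Lemma denq_frac (p q : int) : 0 < q -> coprimez p q -> denq (p%:Q / q%:Q) = q.
Proof.
by move=> q0; rewrite coprimezE => /coprimeq_den ->; rewrite gt_eqF ?gtr0_norm.
Qed.

Lemma conv_denE (b : nat -> int) n : (forall i, (i < n)%N -> 1 <= b i) ->
  conv_den b n = cden b n.+1.
Proof.
case: n => [//|n] b1; rewrite /conv_den partial_quotientsS cfrac_conv //; last 2 first.
- by move=> i /ltnW/b1.
- by rewrite ltr0z (lt_le_trans _ (b1 n _)).
have [//|_ d1] := cden_ge0 b n.
rewrite -!intrM -!intrD (mulrC (cnum b n.+1)) (mulrC (cden b n.+1)) -cnumSS -cdenSS.
by rewrite denq_frac ?coprime_convergents // (lt_le_trans _ d1).
Qed.

(** The last two convergents have determinant 1 or -1, so the sums below are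
    coprime; two reduced fractions with the same value agree. *)
Lemma expansion_convergents (p q : int) m b :
    0 < q -> coprimez p q -> (forall i, (i <= m)%N -> 1 <= b i) ->
    is_expansion (p%:Q / q%:Q) m b ->
  p = cnum b m.+2 + cnum b m.+1 /\ q = cden b m.+2 + cden b m.+1.
Proof.
move=> q0 pq b1 [_]; rewrite cfrac_conv // !mulr1 -!intrD.
set n := _ + _; set d := _ + _ => xE.
have [//|d0 d1] := cden_ge0 b m.
have dgt0 : 0 < d by rewrite /d ltr_pwDl // (lt_le_trans _ d1).
have nd : coprimez n d.
  apply/coprimezP.
  exists ((-1) ^+ m.+1 * cden b m.+1, (-1) ^+ m.+1 * - cnum b m.+1) => /=.
  rewrite -[RHS](sqrr_sign int m.+1) [RHS]expr2 -{4}(conv_det b m.+1) /n /d.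
  ring.
have qd : q = d by rewrite -(denq_frac _ _ q0 pq) xE denq_frac.
split=> //; apply/eqP; rewrite -(eqr_int rat); apply/eqP.
by move: xE; rewrite qd => /divIf; apply; rewrite intr_eq0 gt_eqF.
Qed.

(** Half the length of the interval with endpoints A and B. *)
Definition radius (q b0 : int) : rat := 3 / (4 * b0%:Q * q%:Q ^+ 2).

(** The last entry t of A and B is designed for this: Q t + Q' = 4/3 b_0 q, so
    that the error depends on the neighbour P'/Q' only through the
    determinant. *)
Lemma mobius_radius (P Q P' Q' t : rat) (q b0 : int) :
    Q = q%:Q -> 0 < q -> 0 < b0 -> t = 4 / 3 * b0%:Q - Q' / Q -> 0 < t ->
  (P + P' * t^-1) / (Q + Q' * t^-1) = P / Q + (P' * Q - P * Q') * radius q b0.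
Proof.
move=> -> q0 b00 tE tgt0.
have qQ : q%:Q != 0 by rewrite intr_eq0 gt_eqF.
have bQ : b0%:Q != 0 by rewrite intr_eq0 gt_eqF.
have tn : t != 0 by rewrite gt_eqF.
have denE : q%:Q + Q' * t^-1 = 4 / 3 * b0%:Q * q%:Q * t^-1.
  have -> : Q' = (4 / 3 * b0%:Q - t) * q%:Q by rewrite tE; field.
  by field.
rewrite denE.
transitivity ((P * t + P') / (4 / 3 * b0%:Q * q%:Q)).
  by field; rewrite tn qQ bQ.
by rewrite tE /radius; field; rewrite qQ bQ.
Qed.

Lemma endpointsE (p q : int) m b :
    0 < q -> coprimez p q -> 1 <= b 0%N -> is_expansion (p%:Q / q%:Q) m b ->
  endA q m b = p%:Q / q%:Q + (-1) ^+ m * radius q (b 0%N) /\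
  endB q m b = p%:Q / q%:Q - (-1) ^+ m * radius q (b 0%N).
Proof.
move=> q0 pq b01 xE.
have b1 i : (i <= m)%N -> 1 <= b i.
  by case: i => [//|i] im; case: xE => + _; apply.
have [pE qE] := expansion_convergents p q m b q0 pq b1 xE.
have [//|d0 d1] := cden_ge0 b m.
have b0Q : 1 <= (b 0%N)%:Q by rewrite ler1z.
have qQ : 0 < q%:Q by rewrite ltr0z.
(* The earlier denominators are at most q, so the last entry is positive. *)
have tpos (d : int) : 0 <= d <= q -> 0 < 4 / 3 * (b 0%N)%:Q - d%:Q / q%:Q.
  move=> /andP[dge0 dq].
  have : d%:Q / q%:Q <= 1 by rewrite ler_pdivrMr // mul1r ler_int.
  lra.
have bm : 0 < (b m)%:Q by rewrite ltr0z (lt_le_trans _ (b1 m _)).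
have pQ : p%:Q = (cnum b m.+2)%:Q + (cnum b m.+1)%:Q by rewrite pE intrD.
have qQE : q%:Q = (cden b m.+2)%:Q + (cden b m.+1)%:Q by rewrite qE intrD.
have detE : (cnum b m.+2)%:Q * (cden b m.+1)%:Q
            - (cnum b m.+1)%:Q * (cden b m.+2)%:Q = - (-1) ^+ m.
  by rewrite -!intrM -intrB conv_det exprS mulN1r intrN rmorphXn.
have cfracA t : 0 < t ->
    cfrac (partial_quotients b m ++ [:: (b m)%:Q + 1; t]) =
    (p%:Q + (cnum b m.+1)%:Q * t^-1) / (q%:Q + (cden b m.+1)%:Q * t^-1).
  move=> t0; rewrite cfrac_rcons2 cfrac_conv; last 2 first.
  - by move=> i /ltnW/b1.
  - by rewrite addr_gt0 ?invr_gt0 // addr_gt0.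
  by congr (_ / _); rewrite ?pQ ?qQE (cnumSS, cdenSS) intrD intrM; ring.
have cfracB t : 0 < t ->
    cfrac (partial_quotients b m.+1 ++ [:: 1; t]) =
    (p%:Q + (cnum b m.+2)%:Q * t^-1) / (q%:Q + (cden b m.+2)%:Q * t^-1).
  move=> t0; rewrite cfrac_rcons2 cfrac_conv //; last by rewrite addr_gt0 ?invr_gt0.
  by rewrite pQ qQE; congr (_ / _); ring.
rewrite /endA /endB !conv_denE //; last by move=> i /ltnW/b1.
have tA := tpos (cden b m.+1) ltac:(lia).
have tB := tpos (cden b m.+2) ltac:(lia).
have b00 : 0 < b 0%N by rewrite (lt_le_trans _ b01).
rewrite cfracA // cfracB // !(mobius_radius _ _ _ _ _ q (b 0%N)) //.
split; congr (_ + _).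
- congr (_ * _); rewrite -[RHS]opprK -detE pQ qQE; ring.
- by rewrite -[RHS]mulNr -detE pQ qQE; congr (_ * _); ring.
Qed.

(** * The half-intervals *)

(** The values of X (X - c): for c = 0 and c = 1 these are the norms of
    X - sqrt d and X - (1 + sqrt d) / 2, up to a shift by the integer sought. *)
Definition trace_form (c : int) (x : rat) : rat := x ^+ 2 - c%:Q * x.

Lemma right_componentP (R : realType) (x y c : rat) (d : int) : x < c < y ->
  right_component (open_itv R x y) (ratr c) d%:~R <-> c < d%:Q < y.
Proof.
move=> xcy; rewrite /open_itv right_component_itv ?ltr_rat //=.
by rewrite in_itv /= -(ratr_int R d) !ltr_rat.
Qed.

Lemma left_componentP (R : realType) (x y c : rat) (d : int) : x < c < y ->
  left_component (open_itv R x y) (ratr c) d%:~R <-> x < d%:Q < c.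
Proof.
move=> xcy; rewrite /open_itv left_component_itv ?ltr_rat //=.
by rewrite in_itv /= -(ratr_int R d) !ltr_rat.
Qed.

(** The case distinction on the parity of m undoes the sign (-1)^m of the
    displacements of A and B. *)
Lemma if_odd_itv (R : realType) m (f : rat -> rat) (x e : rat) :
  (if odd m then open_itv R (f (x + (-1) ^+ m * e)) (f (x - (-1) ^+ m * e))
   else open_itv R (f (x - (-1) ^+ m * e)) (f (x + (-1) ^+ m * e))) =
  open_itv R (f (x - e)) (f (x + e)).
Proof. by rewrite -signr_odd; case: (odd m); rewrite ?mulN1r ?mul1r ?opprK. Qed.

Lemma sqr_window (y e : rat) : 0 < e < 2 * y ->
  (y - e) ^+ 2 < y ^+ 2 < (y + e) ^+ 2.
Proof. by move=> /andP[e0 ey]; apply/andP; split; nra. Qed.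

Section Window.
Variables (R : realType) (p q : int) (m : nat) (b : nat -> int).
Hypotheses (q0 : 0 < q) (pq : coprimez p q) (b03 : 3 <= b 0%N).
Hypothesis xE : is_expansion (p%:Q / q%:Q) m b.

Let x := p%:Q / q%:Q.
Let delta := radius q (b 0%N).

Lemma radius_bounds : 0 < delta <= 1 / 4.
Proof.
have b0 : 3 <= (b 0%N)%:Q by rewrite (ler_int _ 3).
have q1 : 1 <= q%:Q ^+ 2 by rewrite exprn_ege1 // ler1z.
have den1 : 12 <= 4 * (b 0%N)%:Q * q%:Q ^+ 2 by nra.
have den0 : 0 < 4 * (b 0%N)%:Q * q%:Q ^+ 2 by rewrite (lt_le_trans _ den1).
rewrite /delta /radius (divr_gt0 _ den0) //= (ler_pdivrMr _ _ den0).
lra.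
Qed.

Lemma expansion_gt3 : 3 < x.
Proof.
have /andP[+ _] := expansion_head _ _ _ xE.
by apply: le_lt_trans; rewrite (ler_int _ 3).
Qed.

Let b01 : 1 <= b 0%N. Proof. exact: le_trans b03. Qed.

Lemma I0E : I0 R q m b = open_itv R ((x - delta) ^+ 2) ((x + delta) ^+ 2).
Proof.
have [eA eB] := endpointsE p q m b q0 pq b01 xE.
by rewrite /I0 eA eB (if_odd_itv R m (fun y => y ^+ 2)).
Qed.

Lemma I1E : I1 R q m b =
  open_itv R ((2 * x - 1 - 2 * delta) ^+ 2) ((2 * x - 1 + 2 * delta) ^+ 2).
Proof.
have [eA eB] := endpointsE p q m b q0 pq b01 xE.
rewrite /I1 eA eB (if_odd_itv R m (fun y => (2 * y - 1) ^+ 2)).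
by congr (open_itv R (_ ^+ 2) (_ ^+ 2)); rewrite /x /delta; ring.
Qed.

Let x3 := expansion_gt3.
Let d_bounds := radius_bounds.

Lemma I0_window : (x - delta) ^+ 2 < x ^+ 2 < (x + delta) ^+ 2.
Proof. by apply: sqr_window; move: x3 d_bounds => ? /andP[-> ?] /=; lra. Qed.

Lemma I1_window :
  (2 * x - 1 - 2 * delta) ^+ 2 < (2 * x - 1) ^+ 2 < (2 * x - 1 + 2 * delta) ^+ 2.
Proof.
apply: sqr_window; move: x3 d_bounds => ? /andP[? ?].
by apply/andP; split; lra.
Qed.

Lemma I0rP (d : int) : I0r R p q m b d%:~R <->
  trace_form 0 x < d%:Q < trace_form 0 (x + delta).
Proof.
rewrite /I0r I0E (right_componentP R _ _ _ d I0_window) /trace_form.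
by rewrite !mul0r !subr0.
Qed.

Lemma I0lP (d : int) : I0l R p q m b d%:~R <->
  trace_form 0 (x - delta) < d%:Q < trace_form 0 x.
Proof.
rewrite /I0l I0E (left_componentP R _ _ _ d I0_window) /trace_form.
by rewrite !mul0r !subr0.
Qed.

Lemma sqr_trace_form (y : rat) : (2 * y - 1) ^+ 2 = 4 * trace_form 1 y + 1.
Proof. by rewrite /trace_form; ring. Qed.

Lemma I1rP (e : int) : I1r R p q m b (e * 4 + 1)%:~R <->
  trace_form 1 x < e%:Q < trace_form 1 (x + delta).
Proof.
rewrite /I1r I1E (right_componentP R _ _ _ _ I1_window).
have -> : 2 * x - 1 + 2 * delta = 2 * (x + delta) - 1 by ring.
rewrite !sqr_trace_form intrD intrM mulrC.
by split=> /andP[? ?]; apply/andP; split; lra.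
Qed.

Lemma I1lP (e : int) : I1l R p q m b (e * 4 + 1)%:~R <->
  trace_form 1 (x - delta) < e%:Q < trace_form 1 x.
Proof.
rewrite /I1l I1E (left_componentP R _ _ _ _ I1_window).
have -> : 2 * x - 1 - 2 * delta = 2 * (x - delta) - 1 by ring.
rewrite !sqr_trace_form intrD intrM mulrC.
by split=> /andP[? ?]; apply/andP; split; lra.
Qed.

End Window.

(** With t = 3 / (4 b_0) and s = t^2 / q^2 the widths are
    (2 x - c) t + s and (2 x - c) t - s.  Since b_0 < x <= b_0 + 1, the product
    2 x t lies between 3/2 and 3/2 + 2 t, and t <= 1/4; the constant 3/4 in the
    definition of the radius leaves room on both sides.  For c = 0 the upper
    bound 3/2 + 2 t + s < 2 requires t < 1/4, that is b_0 >= 4. *)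
Lemma window_width (p q b0 c : int) :
    0 < q -> 3 <= b0 -> b0%:Q < p%:Q / q%:Q <= b0%:Q + 1 -> 0 <= c <= 1 ->
  let x := p%:Q / q%:Q in
  let r := radius q b0 in
  let up := q%:Q ^+ 2 * (trace_form c (x + r) - trace_form c x) in
  let low := q%:Q ^+ 2 * (trace_form c x - trace_form c (x - r)) in
  [/\ 1 < up, c = 1 \/ 4 <= b0 -> up < 2 & 1 < low < 2].
Proof.
move=> q0 b03 /andP[bx xb] c01.
have cE : c = 0 \/ c = 1 by move: c01; clear; lia.
move=> x r up low.
have [t tE] : exists t, t = 3 / (4 * b0%:Q) by eexists.
have [s sE] : exists s, s = t ^+ 2 / q%:Q ^+ 2 by eexists.
have bQ : 3 <= b0%:Q by rewrite (ler_int _ 3).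
have b00 : 0 < b0%:Q by lra.
have q1 : 1 <= q%:Q ^+ 2 by rewrite exprn_ege1 // ler1z.
have q2 : 0 < q%:Q ^+ 2 by rewrite (lt_le_trans ltr01).
have qn : q%:Q != 0 by rewrite intr_eq0 gt_eqF.
have bn : b0%:Q != 0 by rewrite gt_eqF.
have tb : b0%:Q * t = 3 / 4 by rewrite tE; field.
have t0 : 0 < t by rewrite tE divr_gt0 ?mulr_gt0.
have t4 : t <= 1 / 4 by nra.
have s0 : 0 < s by rewrite sE divr_gt0 // exprn_gt0.
have tt : t ^+ 2 <= t / 4 by rewrite expr2 ler_pM2l //; move: t4; lra.
have st : s <= t / 4.
  by rewrite sE (ler_pdivrMr _ _ q2) (le_trans tt) // ler_peMr // divr_ge0 // ltW.
have xt1 : 3 / 4 < x * t by rewrite -tb ltr_pM2r.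
have xt2 : x * t <= 3 / 4 + t by rewrite -tb -[X in _ + X]mul1r -mulrDl ler_pM2r.
have upE : up = 2 * (x * t) - c%:Q * t + s.
  by rewrite /up /trace_form /r /radius sE tE; field; rewrite qn bn.
have lowE : low = 2 * (x * t) - c%:Q * t - s.
  by rewrite /low /trace_form /r /radius sE tE; field; rewrite qn bn.
rewrite upE lowE; clear upE lowE; clear tE sE; clearbody up low r x.
split.
- by case: cE => ->; lra.
- case: cE => -> h; last by lra.
  have b4 : 4 <= b0%:Q by case: h => // h; rewrite (ler_int _ 4).
  have t16 : t <= 3 / 16 by nra.
  lra.
- by apply/andP; split; case: cE => ->; lra.
Qed.

Lemma trace_form_norm (p q c e : int) : 0 < q ->
  q%:Q ^+ 2 * (e%:Q - trace_form c (p%:Q / q%:Q)) =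
  (e * q ^+ 2 - (p ^+ 2 - c * p * q))%:Q.
Proof.
move=> q0; have qn : q%:Q != 0 by rewrite intr_eq0 gt_eqF.
by rewrite /trace_form !(intrB, intrM, rmorphXn) /=; field.
Qed.

Lemma right_window_norm (p q b0 c e : int) : 0 < q ->
  (trace_form c (p%:Q / q%:Q) < e%:Q < trace_form c (p%:Q / q%:Q + radius q b0)) =
  (0 < (e * q ^+ 2 - (p ^+ 2 - c * p * q))%:Q <
   q%:Q ^+ 2 * (trace_form c (p%:Q / q%:Q + radius q b0)
                - trace_form c (p%:Q / q%:Q))).
Proof.
move=> q0; have q2 : 0 < q%:Q ^+ 2 by rewrite exprn_gt0 // ltr0z.
by rewrite -trace_form_norm // pmulr_rgt0 // ltr_pM2l // subr_gt0 ltrD2r.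
Qed.

Lemma left_window_norm (p q b0 c e : int) : 0 < q ->
  (trace_form c (p%:Q / q%:Q - radius q b0) < e%:Q < trace_form c (p%:Q / q%:Q)) =
  (0 < (p ^+ 2 - c * p * q - e * q ^+ 2)%:Q <
   q%:Q ^+ 2 * (trace_form c (p%:Q / q%:Q)
                - trace_form c (p%:Q / q%:Q - radius q b0))).
Proof.
move=> q0; have q2 : 0 < q%:Q ^+ 2 by rewrite exprn_gt0 // ltr0z.
have -> : (p ^+ 2 - c * p * q - e * q ^+ 2)%:Q =
    q%:Q ^+ 2 * (trace_form c (p%:Q / q%:Q) - e%:Q).
  by rewrite -(opprB (e * q ^+ 2)) intrN -trace_form_norm //; ring.
by rewrite pmulr_rgt0 // ltr_pM2l // subr_gt0 ltrD2l ltrN2 andbC.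
Qed.

Lemma int_lt2 (z : int) (w : rat) : w < 2 -> 0 < z%:Q < w -> z = 1.
Proof.
move=> w2 /andP[]; rewrite (ltr_int _ 0) => z0 zw.
have := lt_trans zw w2; rewrite (ltr_int _ _ 2); lia.
Qed.

(** * Integers in the half-intervals *)

Section Solutions.
Variables (p q b0 c e : int).
Hypotheses (q0 : 0 < q) (b03 : 3 <= b0).
Hypotheses (bx : b0%:Q < p%:Q / q%:Q <= b0%:Q + 1) (c01 : 0 <= c <= 1).

Lemma right_window_sol : e * q ^+ 2 = p ^+ 2 - c * p * q + 1 ->
  trace_form c (p%:Q / q%:Q) < e%:Q < trace_form c (p%:Q / q%:Q + radius q b0).
Proof.
have [w1 _ _] := window_width _ _ _ _ q0 b03 bx c01.
by rewrite right_window_norm // => ->; rewrite addrC addKr ltr01.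
Qed.

Lemma right_window_eq : c = 1 \/ 4 <= b0 ->
  trace_form c (p%:Q / q%:Q) < e%:Q < trace_form c (p%:Q / q%:Q + radius q b0) ->
  e * q ^+ 2 = p ^+ 2 - c * p * q + 1.
Proof.
have [_ w2 _] := window_width _ _ _ _ q0 b03 bx c01.
by move=> /w2 {}w2; rewrite right_window_norm // => /(int_lt2 _ _ w2) <-; ring.
Qed.

Lemma left_windowP :
  trace_form c (p%:Q / q%:Q - radius q b0) < e%:Q < trace_form c (p%:Q / q%:Q) <->
  e * q ^+ 2 = p ^+ 2 - c * p * q - 1.
Proof.
have [_ _ /andP[w1 w2]] := window_width _ _ _ _ q0 b03 bx c01.
rewrite left_window_norm //; split=> [/(int_lt2 _ _ w2) <-|->]; first by ring.
by rewrite opprB addrC subrK ltr01.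
Qed.

End Solutions.

(** * The integers of prescribed norm *)

Lemma qnorm_sqrtE (p q d s : int) :
  d * q ^+ 2 = p ^+ 2 - 0 * p * q + s ->
  qnorm (p%:~R - q%:~R * qsqrt d) = (- s)%:~R.
Proof. by rewrite qnorm_sqrt mulrC => ->; congr _%:~R; ring. Qed.

Lemma qnorm_halfE (p q e s : int) :
  e * q ^+ 2 = p ^+ 2 - 1 * p * q + s ->
  qnorm (p%:~R - q%:~R * (2^-1 *: (1 + qsqrt (e * 4 + 1)))) = (- s)%:~R.
Proof.
move=> eE; rewrite qnorm_half quad_intE; congr Quad.
have -> : s = e * q ^+ 2 - (p ^+ 2 - p * q) by rewrite eE; ring.
by rewrite !(intrN, intrB, intrD, intrM, rmorphXn) /=; field.
Qed.

Lemma sqrt_discrE (p q a k d s : int) : q != 0 -> p = a * q + k ->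
  d * q ^+ 2 = p ^+ 2 - 0 * p * q + s ->
  d%:Q = a%:Q ^+ 2 + 2 * k%:Q / q%:Q * a%:Q + (k%:Q ^+ 2 + s%:Q) / q%:Q ^+ 2.
Proof.
move=> q0 -> dE; have qn : q%:Q != 0 by rewrite intr_eq0.
have -> : s = d * q ^+ 2 - (a * q + k) ^+ 2 by rewrite dE; ring.
by rewrite !(intrB, intrD, intrM, rmorphXn) /=; field.
Qed.

Lemma half_discrE (p q a k e s : int) : q != 0 -> p = a * q + k ->
  e * q ^+ 2 = p ^+ 2 - 1 * p * q + s ->
  (e * 4 + 1)%:Q = (2 * a%:Q - 1) ^+ 2 + 4 * k%:Q / q%:Q * (2 * a%:Q - 1)
                   + (4 * k%:Q ^+ 2 + 4 * s%:Q) / q%:Q ^+ 2.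
Proof.
move=> q0 -> eE; have qn : q%:Q != 0 by rewrite intr_eq0.
have -> : s = e * q ^+ 2 - ((a * q + k) ^+ 2 - (a * q + k) * q).
  by rewrite eE; ring.
by rewrite !(intrB, intrD, intrM, rmorphXn) /=; field.
Qed.

Lemma mod4_eq1P (d : int) : (d = 1 %[mod 4])%Z <-> exists e, d = e * 4 + 1.
Proof.
split=> [d1|[e ->]]; last by rewrite modzMDl.
by exists (d %/ 4)%Z; rewrite {1}(divz_eq d 4) d1.
Qed.

(* "The integer d" is unique except in case (1) for p/q = 4, where
   I^{0,+} = (16, 289/16) contains both 17 = a_0^2 + 1 and 18. *)
Theorem theorem3p2 (R : realType) (p q a0 k : int) (m : nat) (b : nat -> int)
    (hq : 1 <= q) (hpq : coprimez p q) (h4 : 4 <= p%:Q / q%:Q)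
    (ha0 : a0 = Num.floor (p%:Q / q%:Q))
    (hk : p%:Q / q%:Q = a0%:Q + k%:Q / q%:Q) (hkq : 0 <= k < q)
    (hb : is_expansion (p%:Q / q%:Q) m b) :
  (* (1) *)
  [/\ (exists d : int, I0r R p q m b d%:~R) <->
      (k ^+ 2 = -1 %[mod q])%Z /\
      (2 * a0 = k * ((1 + k ^+ 2)%R %/ q)%Z %[mod q])%Z,
      (exists d : int, I0r R p q m b d%:~R) ->
      exists d : int, [/\ I0r R p q m b d%:~R,
        d%:Q = a0%:Q ^+ 2 + 2 * k%:Q / q%:Q * a0%:Q
               + (k%:Q ^+ 2 + 1) / q%:Q ^+ 2 &
        qnorm (p%:~R - q%:~R * qsqrt d) = -1] &
      p%:Q / q%:Q != 4 -> forall d : int, I0r R p q m b d%:~R ->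
        d%:Q = a0%:Q ^+ 2 + 2 * k%:Q / q%:Q * a0%:Q
               + (k%:Q ^+ 2 + 1) / q%:Q ^+ 2 /\
        qnorm (p%:~R - q%:~R * qsqrt d) = -1]
  /\
  (* (2) *)
  (((exists d : int, I0l R p q m b d%:~R) <->
      (k ^+ 2 = 1 %[mod q])%Z /\
      (2 * a0 = k * ((1 - k ^+ 2)%R %/ q)%Z %[mod q])%Z) /\
   (forall d : int, I0l R p q m b d%:~R ->
      d%:Q = a0%:Q ^+ 2 + 2 * k%:Q / q%:Q * a0%:Q
             + (k%:Q ^+ 2 - 1) / q%:Q ^+ 2 /\
      qnorm (p%:~R - q%:~R * qsqrt d) = 1))
  /\
  (* (3) *)
  (((exists d : int, I1r R p q m b d%:~R /\ (d = 1 %[mod 4])%Z) <->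
      (k ^+ 2 = -1 %[mod q])%Z /\
      (2 * a0 = 1 + k * ((1 + k ^+ 2)%R %/ q)%Z %[mod q])%Z) /\
   (forall d : int, I1r R p q m b d%:~R -> (d = 1 %[mod 4])%Z ->
      d%:Q = (2 * a0%:Q - 1) ^+ 2 + 4 * k%:Q / q%:Q * (2 * a0%:Q - 1)
             + (4 * k%:Q ^+ 2 + 4) / q%:Q ^+ 2 /\
      qnorm (p%:~R - q%:~R * (2^-1 *: (1 + qsqrt d))) = -1))
  /\
  (* (4) *)
  (((exists d : int, I1l R p q m b d%:~R /\ (d = 1 %[mod 4])%Z) <->
      (k ^+ 2 = 1 %[mod q])%Z /\
      (2 * a0 = 1 + k * ((1 - k ^+ 2)%R %/ q)%Z %[mod q])%Z) /\
   (forall d : int, I1l R p q m b d%:~R -> (d = 1 %[mod 4])%Z ->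
      d%:Q = (2 * a0%:Q - 1) ^+ 2 + 4 * k%:Q / q%:Q * (2 * a0%:Q - 1)
             + (4 * k%:Q ^+ 2 - 4) / q%:Q ^+ 2 /\
      qnorm (p%:~R - q%:~R * (2^-1 *: (1 + qsqrt d))) = 1)).
Proof.
have q0 : 0 < q by [].
have qn : q != 0 by rewrite gt_eqF.
have qQ : q%:Q != 0 by rewrite intr_eq0.
have /andP[b0x xb0] := expansion_head _ _ _ hb.
have b03 : 3 <= b 0%N by rewrite -(ler_int rat); move: h4 xb0; lra.
have bx : (b 0%N)%:Q < p%:Q / q%:Q <= (b 0%N)%:Q + 1 by rewrite b0x xb0.
have b04 : p%:Q / q%:Q != 4 -> 4 <= b 0%N.
  move=> x4; have : 4 < p%:Q / q%:Q by rewrite lt_def x4.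
  move=> /lt_le_trans/(_ xb0); rewrite -ltrBlDr (_ : 4 - 1 = 3%:~R) // ltr_int.
  by rewrite -lezD1.
have pE : p = a0 * q + k.
  apply/eqP; rewrite -(eqr_int rat) intrD intrM; apply/eqP.
  by rewrite -(divfK qQ p%:Q) hk; field.
have I0rE d := I0rP R p q m b q0 hpq b03 hb d.
have I0lE d := I0lP R p q m b q0 hpq b03 hb d.
have I1rE e := I1rP R p q m b q0 hpq b03 hb e.
have I1lE e := I1lP R p q m b q0 hpq b03 hb e.
have dvdE c s := sqr_dvd_normP q a0 k c s qn; rewrite -pE in dvdE.
(* In the exceptional case x = 4 the interval also contains integers that do
   not solve the equation, but a solution exists since q = 1. *)
have x4sol : p%:Q / q%:Q = 4 -> exists d, d * q ^+ 2 = p ^+ 2 - 0 * p * q + 1.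
  move=> x4; have q1 : q = 1.
    by rewrite -(denq_frac _ _ q0 hpq) x4.
  by exists (p ^+ 2 + 1); rewrite q1; ring.
have I0r_sol : (exists d : int, I0r R p q m b d%:~R) ->
    exists d, d * q ^+ 2 = p ^+ 2 - 0 * p * q + 1.
  move=> [d /I0rE dI]; have [/x4sol //|/b04 b4] := eqVneq (p%:Q / q%:Q) 4.
  by exists d; apply: right_window_eq dI => //; right.
have sol_I0r d : d * q ^+ 2 = p ^+ 2 - 0 * p * q + 1 -> I0r R p q m b d%:~R.
  by move=> dE; apply/I0rE; apply: right_window_sol.
have sol1 d : d * q ^+ 2 = p ^+ 2 - 0 * p * q + 1 ->
    d%:Q = a0%:Q ^+ 2 + 2 * k%:Q / q%:Q * a0%:Q + (k%:Q ^+ 2 + 1) / q%:Q ^+ 2 /\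
    qnorm (p%:~R - q%:~R * qsqrt d) = -1.
  by move=> dE; split; [apply: sqrt_discrE dE | rewrite (qnorm_sqrtE _ _ _ _ dE)].
split; last split; last split.
- split.
  + have := dvdE 0 1 (expr1n _ _); rewrite [1 * k ^+ 2]mul1r add0r => <-; split=> [//|[d dE]].
    by exists d; apply: sol_I0r.
  + move=> /I0r_sol[d dE]; have [dF dN] := sol1 d dE.
    by exists d; split=> //; apply: sol_I0r.
  + move=> /b04 b4 d /I0rE dI; apply: sol1.
    by apply: right_window_eq dI => //; right.
- have I0lW d : I0l R p q m b d%:~R <-> d * q ^+ 2 = p ^+ 2 - 0 * p * q + -1.
    by rewrite I0lE; apply: left_windowP.
  split.
    have := dvdE 0 (-1) (sqrrN _); rewrite opprK mulN1r add0r => <-.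
    by split=> -[d /I0lW dE]; exists d.
  move=> d /I0lW dE.
  by split; [apply: sqrt_discrE dE | rewrite (qnorm_sqrtE _ _ _ _ dE)].
- have I1rW e : I1r R p q m b (e * 4 + 1)%:~R <->
      e * q ^+ 2 = p ^+ 2 - 1 * p * q + 1.
    rewrite I1rE; split=> [|eE]; last exact: right_window_sol.
    by apply: right_window_eq => //; left.
  split.
    have := dvdE 1 1 (expr1n _ _); rewrite [1 * k ^+ 2]mul1r => <-; split.
      by move=> [d [+ /mod4_eq1P[e dE]]]; rewrite dE => /I1rW eE; exists e.
    move=> [e /I1rW eI]; exists (e * 4 + 1); split=> //.
    by apply/mod4_eq1P; exists e.
  move=> d + /mod4_eq1P[e dE]; rewrite dE => /I1rW eE.
  split; last by rewrite (qnorm_halfE _ _ _ _ eE).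
  by rewrite (half_discrE _ _ _ _ _ _ qn pE eE) mulr1.
- have I1lW e : I1l R p q m b (e * 4 + 1)%:~R <->
      e * q ^+ 2 = p ^+ 2 - 1 * p * q + -1.
    by rewrite I1lE; apply: left_windowP.
  split.
    have := dvdE 1 (-1) (sqrrN _); rewrite opprK mulN1r => <-; split.
      by move=> [d [+ /mod4_eq1P[e dE]]]; rewrite dE => /I1lW eE; exists e.
    move=> [e /I1lW eI]; exists (e * 4 + 1); split=> //.
    by apply/mod4_eq1P; exists e.
  move=> d + /mod4_eq1P[e dE]; rewrite dE => /I1lW eE.
  split; last by rewrite (qnorm_halfE _ _ _ _ eE).
  by rewrite (half_discrE _ _ _ _ _ _ qn pE eE) mulrN1.
Qed.
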